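(* Let $\boldsymbol{A}\in\mathbb{R}^{n\times n}$ be a symmetric positive semidefinite matrix of rank $r\ge 1$, let $f(\boldsymbol{x})=\|\boldsymbol{x}\|^2-(\boldsymbol{x}^T\boldsymbol{A}\boldsymbol{x})^{1/2}$ on $\mathbb{R}^n$, and let $\alpha\in(0,1)$. Let the initial point $\boldsymbol{x}_0$ be drawn from the set $\{\boldsymbol{x}\in\mathbb{R}^n \mid f(\boldsymbol{x})<0\}$ according to an absolutely continuous probability measure. Then, with probability one, the entire sequence $\{\boldsymbol{x}_k\}$ generated by $\boldsymbol{x}_{k+1}=\boldsymbol{x}_k-\alpha\nabla f(\boldsymbol{x}_k)$ converges to a global minimizer of $f$.
   Context: $\|\cdot\|$ is the Euclidean norm. The function $f$ is differentiable exactly on $\Theta=\{\boldsymbol{x}\in\mathbb{R}^n\mid \boldsymbol{A}\boldsymbol{x}\neq\boldsymbol{0}\}$, where $\nabla f(\boldsymbol{x})=2\boldsymbol{x}-\boldsymbol{A}\boldsymbol{x}/(\boldsymbol{x}^T\boldsymbol{A}\boldsymbol{x})^{1/2}$. When $f(\boldsymbol{x}_0)<0$ all iterates of the gradient descent update stay in $\Theta$, so the sequence is well defined. ''Absolutely continuous'' is with respect to Lebesgue measure. *)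

(* Defs.v *)
From HB Require Import structures.
From mathcomp Require Import all_boot all_order all_algebra.
From mathcomp Require Import all_classical all_reals all_analysis.
From mathcomp Require Import measurable_realfun.

Set Implicit Arguments.
Unset Strict Implicit.
Unset Printing Implicit Defensive.

Import Order.TTheory GRing.Theory Num.Theory.
Import numFieldNormedType.Exports.

Local Open Scope classical_set_scope.
Local Open Scope ring_scope.

(* The library norm `|x| on 'cV[R]_n is the sup norm; it induces the same
   topology, but the objective function needs the Euclidean norm. *)
Definition enorm (R : realType) (n : nat) (x : 'cV[R]_n) : R :=
  Num.sqrt (\sum_(i < n) x i 0 ^+ 2).

Definition quad (R : realType) (n : nat) (A : 'M[R]_n) (x : 'cV[R]_n) : R :=
  (x^T *m A *m x) 0 0.

Definition psd (R : realType) (n : nat) (A : 'M[R]_n) : Prop :=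
  forall x : 'cV[R]_n, 0 <= quad A x.

Definition objective (R : realType) (n : nat) (A : 'M[R]_n) (x : 'cV[R]_n) : R :=
  enorm x ^+ 2 - Num.sqrt (quad A x).

(* Vector of partial derivatives; 'D_v f x is a total operator, with an
   unspecified value where the directional derivative does not exist. *)
Definition gradient (R : realType) (n : nat) (f : 'cV[R]_n -> R) (x : 'cV[R]_n) :
    'cV[R]_n :=
  \col_i 'D_(delta_mx i 0) f x.

Definition gradient_descent (R : realType) (n : nat) (f : 'cV[R]_n -> R)
    (alpha : R) (x0 : 'cV[R]_n) (k : nat) : 'cV[R]_n :=
  iter k (fun x => x - alpha *: gradient f x) x0.

Definition global_minimizer (R : realType) (n : nat) (f : 'cV[R]_n -> R)
    (x : 'cV[R]_n) : Prop :=
  forall y, f x <= f y.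

Notation borel_cV R n := (g_sigma_algebraType (@open 'cV[R]_n)).

(* Lebesgue measure on the Borel sets of R^n, as the n-fold product of
   one-dimensional Lebesgue measure, transported along R * R^n ~ R^(n+1). *)
Fixpoint lebesgue_cV (R : realType) (n : nat) : set (borel_cV R n) -> \bar R :=
  match n return set (borel_cV R n) -> \bar R with
  | 0%N => \d_(0 : borel_cV R 0)
  | m.+1 => pushforward (lebesgue_measure \x @lebesgue_cV R m)%E
      (fun p : measurableTypeR R * borel_cV R m =>
         col_mx (const_mx p.1 : 'cV[R]_1) (p.2 : 'cV[R]_m) : borel_cV R m.+1)
  end.

Lemma lebesgue_cV0 (R : realType) (n : nat) : @lebesgue_cV R n set0 = 0%E.
Proof.
elim: n => [|n IH] /=; first by rewrite diracE in_set0.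
rewrite /pushforward preimage_set0 /product_measure1 integral0_eq// => x _ /=.
by rewrite xsection0.
Qed.

Lemma lebesgue_cV_box (R : realType) (n : nat) (a b : 'cV[R]_n) :
  (forall i, a i 0 <= b i 0) ->
  @lebesgue_cV R n [set x : 'cV[R]_n | forall i, a i 0 <= x i 0 <= b i 0] =
  (\prod_(i < n) (b i 0 - a i 0))%:E.
Proof.
elim: n a b => [|n IH] a b ab.
  rewrite /= big_ord0 diracE mem_set//.
  by move=> -[].
rewrite big_ord_recl /= /pushforward /product_measure1.
set B := \prod_(_ < _) _.
pose a' : 'cV[R]_n := \col_i a (lift ord0 i) 0.
pose b' : 'cV[R]_n := \col_i b (lift ord0 i) 0.
have col0 (x : R) (v : 'cV[R]_n) :
    (col_mx (const_mx x : 'cV[R]_1) v : 'cV[R]_n.+1) ord0 0 = x.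
  have e : (ord0 : 'I_n.+1) = lshift n (ord0 : 'I_1) by apply: val_inj.
  by rewrite e; rewrite (@col_mxEu R 1 n 1 (const_mx x) v ord0 0) mxE.
have colS (x : R) (v : 'cV[R]_n) i :
    (col_mx (const_mx x : 'cV[R]_1) v : 'cV[R]_n.+1) (lift ord0 i) 0 = v i 0.
  have -> : lift ord0 i = rshift 1 i by apply: val_inj.
  by rewrite (@col_mxEd R 1 n 1 (const_mx x) v i 0).
have BE : B%:E = @lebesgue_cV R n [set x : 'cV[R]_n | forall i, a' i 0 <= x i 0 <= b' i 0].
  rewrite IH; last by move=> i; rewrite !mxE.
  by congr EFin; apply: eq_bigr => i _; rewrite !mxE.
transitivity (\int[lebesgue_measure]_(x in setT) ((\1_(`[a ord0 0, b ord0 0]%classic) x)%:E * B%:E))%E.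
  apply: eq_integral => x _ /=.
  rewrite indicE; case: (boolP (x \in _)) => [|] /=; rewrite ?inE ?notin_setE /= => xab.
    rewrite mul1e BE; congr (lebesgue_cV _); apply/seteqP; split => v /=.
      rewrite /xsection /= inE /= => h i; rewrite !mxE.
      by have := h (lift ord0 i); rewrite colS.
    move=> h; rewrite /xsection /= inE /= => i.
    case: (unliftP ord0 i) => [j ->|->]; last by rewrite col0; move: xab; rewrite in_itv.
    by rewrite colS; have := h j; rewrite !mxE.
  rewrite mul0e -(lebesgue_cV0 R n); congr (lebesgue_cV _).
  apply/seteqP; split => v //=.
  rewrite /xsection /= inE /= => /(_ ord0); rewrite col0 => h.
  by apply: xab; rewrite in_itv.
have B0 : (0 <= B%:E)%E.
  by rewrite lee_fin; apply: prodr_ge0 => i _; rewrite subr_ge0.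
rewrite ge0_integralZr//; last by apply/measurable_EFinP; exact: measurable_indic.
rewrite integral_indic//.
rewrite setIT.
pose I : interval R := `[a ord0 0, b ord0 0]%R.
transitivity (lebesgue_measure [set` I] * B%:E)%E; first by [].
rewrite lebesgue_measure_itv /=.
rewrite lte_fin; have := ab ord0; rewrite le_eqVlt => /orP[/eqP <-|h].
  by rewrite ltxx mul0e subrr mul0r.
by rewrite h -EFinB -EFinM.
Qed.

(* Main.v *)
(* Let lam be the largest eigenvalue of A and Pi the orthogonal projection on
   its eigenspace, and write q_k := sqrt (quad A x_k). A step of gradient
   descent acts on the eigenspace by the scalar 1 - 2 alpha + alpha lam / q_k,
   which is positive since f x_k < 0 forces q_k < lam; so Pi x_k = s_k (Pi x_0)
   with s_k > 0. Convexity of sqrt (quad A) gives the descent inequality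
     f x_{k+1} <= f x_k - alpha (1 - alpha) |grad f x_k|^2,
   hence grad f x_k -> 0. If 2 q_k stays below lam, then s_k grows
   geometrically; if 2 q_k is near or above lam, the spectral gap makes
   x_k - Pi x_k small, so s_k is bounded below. Therefore s_k stays away from
   0, which with grad f x_k -> 0 forces 2 q_k -> lam, x_k - Pi x_k -> 0 and the
   convergence of s_k. Only Pi x_0 = 0 is to be avoided, and this
   confines x_0 to a hyperplane. *)

Require Import Defs.
From HB Require Import structures.
From mathcomp Require Import all_boot all_order all_algebra.
From mathcomp Require Import all_classical all_reals all_analysis.
From mathcomp Require Import measurable_realfun.
From mathcomp Require Import ring lra.

Set Implicit Arguments.
Unset Strict Implicit.
Unset Printing Implicit Defensive.

Import Order.TTheory GRing.Theory Num.Theory.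
Import numFieldNormedType.Exports.

Local Open Scope classical_set_scope.
Local Open Scope ring_scope.

(** * Euclidean inner product and quadratic forms *)

Definition dot (R : realType) (n : nat) (x y : 'cV[R]_n) : R := (x^T *m y) 0 0.

Section Dot.
Variables (R : realType) (n : nat).
Implicit Types (x y z : 'cV[R]_n) (M : 'M[R]_n) (a : R).

Lemma dotE x y : dot x y = \sum_i x i 0 * y i 0.
Proof. by rewrite /dot mxE; apply: eq_bigr => i _; rewrite mxE. Qed.

Lemma dotC x y : dot x y = dot y x.
Proof. by rewrite !dotE; apply: eq_bigr => i _; rewrite mulrC. Qed.

Lemma dotDr x y z : dot x (y + z) = dot x y + dot x z.
Proof. by rewrite /dot mulmxDr mxE. Qed.

Lemma dotDl x y z : dot (x + y) z = dot x z + dot y z.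
Proof. by rewrite ![dot _ z]dotC dotDr. Qed.

Lemma dotZr a x y : dot x (a *: y) = a * dot x y.
Proof. by rewrite /dot -scalemxAr mxE. Qed.

Lemma dotZl a x y : dot (a *: x) y = a * dot x y.
Proof. by rewrite ![dot _ y]dotC dotZr. Qed.

Lemma dotNr x y : dot x (- y) = - dot x y.
Proof. by rewrite -scaleN1r dotZr mulN1r. Qed.

Lemma dotNl x y : dot (- x) y = - dot x y.
Proof. by rewrite ![dot _ y]dotC dotNr. Qed.

Lemma dot0r x : dot x 0 = 0.
Proof. by rewrite -(scale0r 0) dotZr mul0r. Qed.

Lemma dot_mulmxr M x y : dot x (M *m y) = dot (M^T *m x) y.
Proof. by rewrite /dot trmx_mul trmxK mulmxA. Qed.

Lemma dot_ge0 x : 0 <= dot x x.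
Proof. by rewrite dotE; apply: sumr_ge0 => i _; rewrite -expr2 sqr_ge0. Qed.

Lemma sqr_coord_le_dot x i : x i 0 ^+ 2 <= dot x x.
Proof.
rewrite dotE (bigD1 i)//= -expr2 lerDl.
by apply: sumr_ge0 => j _; rewrite -expr2 sqr_ge0.
Qed.

Lemma dot_eq0 x : dot x x = 0 -> x = 0.
Proof.
move=> x0; apply/colP => i; rewrite mxE.
by apply/eqP; rewrite -sqrf_eq0 eq_le sqr_ge0 andbT -x0 sqr_coord_le_dot.
Qed.

Lemma quadE M x : quad M x = dot x (M *m x).
Proof. by rewrite /quad /dot mulmxA. Qed.

Lemma enorm_sqr x : enorm x ^+ 2 = dot x x.
Proof.
rewrite sqr_sqrtr; last by apply: sumr_ge0 => i _; rewrite sqr_ge0.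
by rewrite dotE; apply: eq_bigr => i _; rewrite expr2.
Qed.

Lemma quadZ M a x : quad M (a *: x) = a ^+ 2 * quad M x.
Proof. by rewrite !quadE -scalemxAr dotZl dotZr; ring. Qed.

Lemma quadD M x y : M^T = M ->
  quad M (x + y) = quad M x + 2 * dot y (M *m x) + quad M y.
Proof.
move=> symM; rewrite !quadE mulmxDr !dotDl !dotDr [dot x (M *m y)]dot_mulmxr.
by rewrite symM [dot (M *m x) y]dotC; ring.
Qed.

(** Since [|w_i w_j| <= dot w w], the sum of the [|M i j|] is a valid constant; adding 1 makes it
    positive, so that it can be inverted. *)
Lemma quad_bounded M : exists2 D, 0 < D & forall w, quad M w <= D * dot w w.
Proof.
exists (1 + \sum_i \sum_j `|M i j|) => [|w].
  by rewrite ltr_pwDl// sumr_ge0// => i _; rewrite sumr_ge0.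
rewrite mulrDl mul1r quadE [dot w (_ *m _)]dotE.
apply: ler_wpDl; first exact: dot_ge0.
rewrite mulr_suml; apply: ler_sum => i _; rewrite mxE mulr_sumr mulr_suml.
apply: ler_sum => j _; apply: (le_trans (ler_norm _)).
rewrite mulrCA normrM ler_wpM2l// ler_norml.
have := sqr_coord_le_dot w i; have := sqr_coord_le_dot w j.
have := sqr_ge0 (w i 0 - w j 0); have := sqr_ge0 (w i 0 + w j 0).
by move=> *; apply/andP; split; nra.
Qed.

(** The polynomial [t |-> quad M (x + t *: y)] is nonnegative; this is its discriminant
    condition. *)
Lemma psd_cauchy_schwarz M x y : M^T = M -> psd M ->
  dot x (M *m y) ^+ 2 <= quad M x * quad M y.
Proof.
move=> symM psdM; set b := dot _ _.
have pos t : 0 <= quad M x + 2 * t * b + t ^+ 2 * quad M y.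
  have := psdM (x + t *: y).
  rewrite quadD// quadZ dotZl [dot y _]dot_mulmxr symM dotC -/b.
  by rewrite mulrA.
have := psdM y; rewrite le_eqVlt => /predU1P[y0|y0]; last first.
  have := pos (- b / quad M y); rewrite -(ler_pM2r y0) mul0r.
  suff -> : (quad M x + 2 * (- b / quad M y) * b +
    (- b / quad M y) ^+ 2 * quad M y) * quad M y = quad M x * quad M y - b ^+ 2.
    by rewrite subr_ge0.
  by field; rewrite gt_eqF.
have [b0|b0] := eqVneq b 0; first by rewrite b0 -y0 expr0n /= mulr0.
(* The polynomial is now affine with slope [2 * b], and takes the value -1 at this point. *)
have := pos (- (quad M x + 1) / (2 * b)); rewrite -y0.
suff -> : quad M x + 2 * (- (quad M x + 1) / (2 * b)) * b +
  (- (quad M x + 1) / (2 * b)) ^+ 2 * 0 = -1 by rewrite ler0N1.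
by field.
Qed.

End Dot.

(** * Spectral projection onto the top eigenspace *)

(** If [u B B = 0] then [|u B|^2 = 0], so [B] and [B B] have the same left kernel, rank and row
    space. Transposing [B = W B B] yields [H]. *)
Lemma sym_range_sqr (R : realType) (n : nat) (B : 'M[R]_n) : B^T = B ->
  exists H, B = B *m B *m H.
Proof.
move=> symB.
have ker (u : 'rV[R]_n) : u *m (B *m B) = 0 -> u *m B = 0.
  move=> uBB; apply: trmx_inj; rewrite trmx0; apply: dot_eq0.
  by rewrite /dot trmxK trmx_mul symB mulmxA -(mulmxA u) uBB mul0mx mxE.
have sub : (B <= B *m B)%MS.
  have BBB : (B *m B <= B)%MS by rewrite submxMl.
  rewrite -(geq_leqif (mxrank_leqif_sup BBB)).
  have : (kermx (B *m B) <= kermx B)%MS.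
    apply/sub_kermxP/row_matrixP => i; rewrite row_mul row0; apply: ker.
    by rewrite -row_mul mulmx_ker row0.
  by move/mxrankS; rewrite !mxrank_ker leq_sub2lE ?rank_leq_row.
have /submxP[W BE] := sub.
by exists W^T; apply: trmx_inj; rewrite !trmx_mul trmxK symB.
Qed.

(* With lam the supremum of the Rayleigh quotient, B = lam - A is psd and
   B = B^2 H, so Pi = 1 - B H projects onto ker B. Cauchy-Schwarz for B
   gives the gap on ker Pi; if Pi vanished, the gap would contradict the choice
   of lam. *)
Lemma top_eigenprojection (R : realType) (n : nat) (A : 'M[R]_n) :
  A^T = A -> (exists x, 0 < quad A x) ->
  exists lam gam (Pi : 'M[R]_n),
    [/\ 0 < lam, 0 < gam & Pi != 0] /\
    [/\ Pi^T = Pi, Pi *m Pi = Pi, A *m Pi = lam *: Pi,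
        forall x, quad A x <= lam * dot x x &
        forall y, Pi *m y = 0 -> quad A y <= (lam - gam) * dot y y].
Proof.
move=> symA [x0 qx0].
have dotp (x : 'cV[R]_n) : x != 0 -> 0 < dot x x.
  by move=> x0'; rewrite lt_def dot_ge0 andbT; apply: contra_neq x0' => /dot_eq0.
have x0N : x0 != 0.
  by apply: contraTneq qx0 => ->; rewrite quadE mulmx0 dot0r ltxx.
pose S := [set l | forall x, quad A x <= l * dot x x].
have Slb (x : 'cV[R]_n) : x != 0 -> lbound S (quad A x / dot x x).
  by move=> /dotp x_gt0 l Sl; rewrite ler_pdivrMr//; exact: Sl.
have S0 : S !=set0 by have [D _ DA] := quad_bounded A; exists D.
have Sinf : has_inf S by split=> //; exists (quad A x0 / dot x0 x0); exact: Slb.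
pose lam := inf S.
have Alam x : quad A x <= lam * dot x x.
  have [->|xN] := eqVneq x 0; first by rewrite quadE mulmx0 !dot0r mulr0.
  by rewrite -ler_pdivrMr ?dotp//; apply: lb_le_inf => //; exact: Slb.
have lam0 : 0 < lam.
  by have := lt_le_trans qx0 (Alam x0); rewrite pmulr_lgt0// dotp.
pose B : 'M[R]_n := lam%:M - A.
have symB : B^T = B by rewrite /B linearB /= tr_scalar_mx symA.
have quadB x : quad B x = lam * dot x x - quad A x.
  by rewrite !quadE /B mulmxBl mul_scalar_mx dotDr dotNr dotZr.
have psdB : psd B by move=> x; rewrite quadB subr_ge0.
have [H BE] := sym_range_sqr symB.
pose Pi : 'M[R]_n := 1%:M - B *m H.
have BPi : B *m Pi = 0 by rewrite /Pi mulmxBr mulmx1 mulmxA -BE subrr.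
(* [Pi^T B = (B Pi)^T = 0]. The identity gives both symmetry and idempotence of [Pi]. *)
have PiTPi : Pi^T *m Pi = Pi^T.
  rewrite {2}/Pi mulmxBr mulmx1 mulmxA.
  by rewrite -{1}symB -trmx_mul BPi trmx0 mul0mx subr0.
have symPi : Pi^T = Pi.
  by have := congr1 trmx PiTPi; rewrite trmx_mul trmxK PiTPi.
have [D D0 DH] := quad_bounded (H^T *m B *m H).
(* Here [y = B H y], so [|y|^4 <= quad B y * quad B (H y) <= quad B y * D |y|^2], which bounds
   [quad B y] below by [D^-1 |y|^2]. *)
have gap y : Pi *m y = 0 -> quad A y <= (lam - D^-1) * dot y y.
  rewrite /Pi mulmxBl mul1mx => /subr0_eq; rewrite -mulmxA => yE.
  have := psd_cauchy_schwarz y (H *m y) symB psdB; rewrite -yE.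
  have -> : quad B (H *m y) = quad (H^T *m B *m H) y.
    by rewrite !quadE -!mulmxA [RHS]dot_mulmxr trmxK.
  move=> CS; rewrite mulrBl lerBrDr -lerBrDl -quadB.
  have [y0|yN] := eqVneq y 0; first by rewrite y0 quadE mulmx0 !dot0r mulr0.
  rewrite ler_pdivrMl// -(ler_pM2r (dotp y yN)) -expr2.
  by rewrite (le_trans CS)// [D * _]mulrC -mulrA ler_wpM2l//; exact: psdB.
exists lam, D^-1, Pi; split; split => //; rewrite ?invr_gt0//.
- apply/eqP => Pi0.
  have /(ge_inf Sinf.2) : S (lam - D^-1).
    by move=> x; apply: gap; rewrite Pi0 mul0mx.
  by rewrite -/lam lerBrDr gerDl leNgt invr_gt0 D0.
- by rewrite -{1}symPi PiTPi.
- by have /eqP := BPi; rewrite /B mulmxBl subr_eq0 mul_scalar_mx => /eqP.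
Qed.

(** * The gradient and the descent inequality *)

Lemma is_derive_quadratic (R : realType) (a b c : R) :
  is_derive (0 : R) 1 (fun t : R => c + t * b + t ^+ 2 * a) b.
Proof.
by apply: is_derive_eq; rewrite /GRing.scale /=; ring.
Qed.

(** Along a coordinate direction the objective is [p - sqrt u] with quadratic polynomials [p] and
    [u], and [u 0 > 0] makes the square root differentiable there. *)
Lemma gradient_objective (R : realType) (n : nat) (A : 'M[R]_n) (x : 'cV[R]_n) :
  A^T = A -> 0 < quad A x ->
  gradient (objective A) x = 2 *: x - (Num.sqrt (quad A x))^-1 *: (A *m x).
Proof.
move=> symA qx; apply/colP => i; rewrite [LHS]mxE.
set v := delta_mx i 0.
have dotv (z : 'cV[R]_n) : dot v z = z i 0.
  rewrite dotE (bigD1 i)//= big1 => [|j ji]; rewrite !mxE ?eqxx ?mul1r ?addr0//.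
  by rewrite (negbTE ji) mul0r.
pose u (t : R) := quad A x + t * (2 * dot v (A *m x)) + t ^+ 2 * quad A v.
pose p (t : R) := dot x x + t * (2 * dot v x) + t ^+ 2 * dot v v.
have fE h : objective A (h *: v + x) = p h - Num.sqrt (u h).
  rewrite /objective enorm_sqr [h *: v + x]addrC quadD// quadZ dotZl.
  congr (_ - Num.sqrt _).
    by rewrite /p !dotDl !dotDr !dotZl !dotZr [dot x v]dotC; ring.
  by rewrite /u; ring.
have u0 : u 0 = quad A x by rewrite /u expr0n /= !mul0r !addr0.
have -> : 'D_v (objective A) x = 'D_1 (fun t : R => p t - Num.sqrt (u t)) 0.
  rewrite /derive; apply: (congr1 (fun F : R -> R => lim (F h @[h --> 0^']))).
  apply/funext => h /=; rewrite fE addr0 [h%:A]mulr1.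
  by have := fE 0; rewrite scale0r add0r => ->.
have Dsq : is_derive (0 : R) 1 (fun t : R => Num.sqrt (u t))
    ((2 * Num.sqrt (quad A x))^-1 * (2 * dot v (A *m x))).
  have Du : is_derive (0 : R) 1 u (2 * dot v (A *m x)).
    exact: is_derive_quadratic.
  have Ds : is_derive (u 0) 1 Num.sqrt (2 * Num.sqrt (quad A x))^-1.
    by rewrite -u0; apply: is_derive1_sqrt; rewrite u0.
  exact: is_derive1_comp.
have Dp : is_derive (0 : R) 1 p (2 * dot v x) by exact: is_derive_quadratic.
rewrite derive_val.
have sq0 : Num.sqrt (quad A x) != 0 by rewrite gt_eqF// sqrtr_gt0.
by rewrite !dotv !mxE; field.
Qed.

(* Cauchy-Schwarz for A says that the tangent of sqrt (quad A) at x, namely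
   y |-> y . A x / sqrt (quad A x), minorizes it. *)
Lemma gradient_step_descent (R : realType) (n : nat) (A : 'M[R]_n)
    (alpha : R) (x : 'cV[R]_n) :
  A^T = A -> psd A -> 0 < quad A x ->
  objective A (x - alpha *: gradient (objective A) x) <=
    objective A x - alpha * (1 - alpha) *
      dot (gradient (objective A) x) (gradient (objective A) x).
Proof.
move=> symA psdA qx; set g := gradient _ _; set y := x - _.
set q := Num.sqrt (quad A x).
have q0 : 0 < q by rewrite sqrtr_gt0.
have AxE : q^-1 *: (A *m x) = 2 *: x - g.
  by rewrite /g gradient_objective// opprB addrCA subrr addr0.
have qyE : dot y (2 *: x - g) <= Num.sqrt (quad A y).
  rewrite -AxE dotZr ler_pdivrMl// mulrC; apply: (le_trans (ler_norm _)).
  by rewrite -sqrtr_sqr -sqrtrM// ler_sqrt ?mulr_ge0// psd_cauchy_schwarz.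
have qxE : q = dot x (2 *: x - g).
  by rewrite -AxE dotZr -quadE -[quad A x]sqr_sqrtr// -/q expr2 mulKf// gt_eqF.
have -> : objective A x = dot x x - dot x (2 *: x - g).
  by rewrite -qxE /objective enorm_sqr.
(* Replacing the square root by its tangent at [x] leaves a quadratic whose value at [y] is exactly
   the right-hand side. *)
apply: (@le_trans _ _ (dot y y - dot y (2 *: x - g))).
  by rewrite /objective enorm_sqr lerD2l lerN2.
rewrite /y !(dotDl, dotDr, dotNl, dotNr, dotZl, dotZr) [dot g x]dotC.
by rewrite le_eqVlt; apply/orP; left; apply/eqP; ring.
Qed.

Lemma quad_gt0_of_objective_lt0 (R : realType) (n : nat) (A : 'M[R]_n)
    (x : 'cV[R]_n) :
  objective A x < 0 -> 0 < quad A x.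
Proof.
by rewrite /objective subr_lt0 -sqrtr_gt0; apply: le_lt_trans; rewrite sqr_ge0.
Qed.

(** * Objective values along the iteration *)

Section GradientTrajectory.
Variables (R : realType) (n : nat) (A : 'M[R]_n) (alpha lam : R).
Hypotheses (symA : A^T = A) (psdA : psd A) (alpha01 : 0 < alpha < 1).
Hypotheses (lam0 : 0 < lam) (quad_le : forall x, quad A x <= lam * dot x x).

(** With [q = sqrt (quad A x)], [q^2 <= lam |x|^2 < lam q]. *)
Lemma sqrt_quad_lt (x : 'cV[R]_n) :
  objective A x < 0 -> Num.sqrt (quad A x) < lam.
Proof.
move=> fx0; have := quad_gt0_of_objective_lt0 fx0.
rewrite -sqrtr_gt0 => q0; rewrite -(ltr_pM2r q0) -expr2 sqr_sqrtr//.
apply: (le_lt_trans (quad_le x)); rewrite ltr_pM2l// -enorm_sqr -subr_lt0.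
exact: fx0.
Qed.

(** The objective is at least [q^2 / lam - q], which is smallest at [q = lam / 2]. *)
Lemma objective_ge (x : 'cV[R]_n) : - (lam / 4) <= objective A x.
Proof.
rewrite /objective enorm_sqr; set q := Num.sqrt _.
have q2 : q ^+ 2 <= lam * dot x x by rewrite sqr_sqrtr.
rewrite -(ler_pM2l lam0); have := sqr_ge0 (q - lam / 2); nra.
Qed.

Variable x0 : 'cV[R]_n.
Hypothesis fx0 : objective A x0 < 0.
Let x := gradient_descent (objective A) alpha x0.
Let g k := gradient (objective A) (x k).

Lemma gradient_descentS k : x k.+1 = x k - alpha *: g k.
Proof. by rewrite /x /gradient_descent iterS. Qed.

(** Keeps every iterate where [quad A] is positive and the gradient formula is valid. *)
Lemma objective_gradient_descent_lt0 k : objective A (x k) < 0.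
Proof.
elim: k => // k IH; rewrite gradient_descentS.
apply: le_lt_trans (IH).
apply: le_trans (gradient_step_descent _ _ _ _) _ => //.
  exact: quad_gt0_of_objective_lt0.
have /andP[a0 a1] := alpha01.
by rewrite gerBl mulr_ge0 ?dot_ge0// mulr_ge0 ?subr_ge0 ?ltW.
Qed.

Lemma objective_gradient_descent_descent k :
  objective A (x k.+1) <=
    objective A (x k) - alpha * (1 - alpha) * dot (g k) (g k).
Proof.
rewrite gradient_descentS; apply: gradient_step_descent => //.
exact/quad_gt0_of_objective_lt0/objective_gradient_descent_lt0.
Qed.

Lemma objective_gradient_descent_noninc :
  nonincreasing_seq (fun k => objective A (x k)).
Proof.
apply/nonincreasing_seqP => k.
apply: le_trans (objective_gradient_descent_descent k) _.
have /andP[a0 a1] := alpha01.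
by rewrite gerBl mulr_ge0 ?dot_ge0// mulr_ge0 ?subr_ge0 ?ltW.
Qed.

(** The objective values decrease and are bounded below, so their successive differences vanish; up
    to a constant these dominate the squared gradient norm. *)
Lemma gradient_cvg0 : dot (g k) (g k) @[k --> \oo] --> (0 : R).
Proof.
have /andP[a0 a1] := alpha01.
have c0 : 0 < alpha * (1 - alpha) by rewrite mulr_gt0// subr_gt0.
have cf : cvgn (fun k => objective A (x k)).
  apply: nonincreasing_is_cvgn objective_gradient_descent_noninc _.
  by exists (- (lam / 4)) => _ [k _ <-]; exact: objective_ge.
have d0 : (alpha * (1 - alpha))^-1 * (objective A (x k) - objective A (x k.+1))
    @[k --> \oo] --> (0 : R).
  rewrite -(mulr0 (alpha * (1 - alpha))^-1); apply: cvgMr.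
  rewrite -(subrr (limn (fun k => objective A (x k)))).
  by apply: cvgB => //; rewrite (cvg_shiftS (fun k => objective A (x k))).
apply: squeeze_cvgr d0; last exact: cvg_cst.
apply: nearW => k; rewrite dot_ge0 ler_pdivlMl//=.
by rewrite lerBrDr addrC -lerBrDr objective_gradient_descent_descent.
Qed.

End GradientTrajectory.

(** * Scalar recurrences *)

(** Below [rho] only the growth alternative can hold, and it cannot last forever. Once [rho] is
    reached, either alternative keeps the next term above it. *)
Lemma eventually_ge_of_growth (R : realType) (s : nat -> R) (rho eta : R) :
  (forall k, 0 < s k) -> 0 < rho -> 0 < eta ->
  (\forall k \near \oo,
    (1 + eta) * s k <= s k.+1 \/ (2 * rho <= s k /\ rho <= s k.+1)) ->
  \forall k \near \oo, rho <= s k.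
Proof.
move=> s0 rho0 eta0 [N _ HN].
have [K [NK sK]] : exists K, (N <= K)%N /\ rho <= s K.
  apply: contrapT => noK.
  have lt k : (N <= k)%N -> s k < rho.
    by move=> Nk; rewrite ltNge; apply/negP => ?; apply: noK; exists k.
  (* Bernoulli's lower bound for [(1 + eta) ^ j], unbounded by the Archimedean property. *)
  have grow j : (1 + j%:R * eta) * s N <= s (N + j)%N.
    elim: j => [|j IH]; first by rewrite mul0r addr0 mul1r addn0.
    have [|[ge _]] := HN (N + j)%N (leq_addr _ _); last first.
      have := lt _ (leq_addr j N). move=> ?; lra.
    rewrite addnS; apply: le_trans.
    apply: le_trans (_ : (1 + eta) * ((1 + j%:R * eta) * s N) <= _).
      rewrite mulrA ler_pM2r// -natr1.
      by have := mulr_ge0 (ler0n R j) (sqr_ge0 eta); nra.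
    by rewrite ler_pM2l// addr_gt0.
  have := archi_boundP (ltW (divr_gt0 rho0 (mulr_gt0 eta0 (s0 N)))).
  set j := Num.bound _; rewrite ltr_pdivrMr ?mulr_gt0// => jlt.
  have := grow j; have := lt _ (leq_addr j N); have := s0 N.
  by move=> *; nra.
exists K => // k /= Kk; rewrite -(subnKC Kk); elim: (k - K)%N => [|j IH].
  by rewrite addn0.
rewrite addnS; have [|[]//] := HN (K + j)%N (leq_trans NK (leq_addr _ _)).
by apply: le_trans; have := s0 (K + j)%N; nra.
Qed.

(* Scalar summary of the iteration: q = sqrt (quad A x_k), Pi x_k = s (Pi x_0),
   P = |Pi x_0|^2, e = |x_k - Pi x_k|^2, t = quad A (x_k - Pi x_k) and
   G = |q grad f x_k|^2. *)
Lemma scalar_dynamics_cvg (R : realType) (lam gam del alpha P : R)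
    (q s e t G : nat -> R) :
  0 < lam -> 0 < gam -> 0 < del -> 0 < alpha < 1 -> 0 < P ->
  (forall k, del <= q k < lam) ->
  0 < s 0 -> (forall k, s k.+1 = s k * (1 - 2 * alpha + alpha * lam / q k)) ->
  (forall k, 0 <= e k) -> (forall k, 0 <= t k <= lam * e k) ->
  (forall k, q k ^+ 2 = lam * P * s k ^+ 2 + t k) ->
  (forall k, (lam - 2 * q k) ^+ 2 * (P * s k ^+ 2) <= G k) ->
  (forall k, lam - gam <= 2 * q k -> gam ^+ 2 * e k <= G k) ->
  G @ \oo --> 0 ->
  s @ \oo --> Num.sqrt (lam / (4 * P)) /\ e @ \oo --> 0.
Proof.
move=> lam0 gam0 del0 /andP[a0 a1] P0 hq s00 hs e0 ht hq2 hp he G0.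
have q0 k : 0 < q k by have /andP[+ _] := hq k; exact: lt_le_trans.
(* In this form the multiplier exceeds 1 exactly when [2 * q k < lam]. *)
have mE k : 1 - 2 * alpha + alpha * lam / q k =
    1 + alpha * ((lam - 2 * q k) / q k).
  by field; rewrite gt_eqF.
have s0 k : 0 < s k.
  elim: k => // k IH; rewrite hs mulr_gt0//.
  have : 1 < lam / q k by rewrite ltr_pdivlMr// mul1r; case/andP: (hq k).
  by rewrite -mulrA => ?; nra.
(* Since [q k >= del], [hq2] forces [s k >= 2 * rho] as soon as [t k <= del ^+ 2 / 2]. *)
have [rho rho0 rho2] :
    exists2 rho, 0 < rho & lam * P * (2 * rho) ^+ 2 = del ^+ 2 / 2.
  have lP0 : 0 < 2 * lam * P by rewrite !mulr_gt0.
  exists (del / (2 * Num.sqrt (2 * lam * P))).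
    by rewrite divr_gt0// mulr_gt0// sqrtr_gt0.
  transitivity (lam * P * (del ^+ 2 / (2 * lam * P))); last first.
    by field; rewrite !gt_eqF.
  rewrite -[in RHS](sqr_sqrtr (ltW lP0)); congr (_ * _).
  by field; rewrite gt_eqF// sqrtr_gt0.
have Prho0 : 0 < P * rho ^+ 2 by rewrite mulr_gt0// exprn_gt0.
have Glt c : 0 < c -> \forall k \near \oo, G k < c.
  by move=> c0; exact: cvgr_lt G0 _ c0.
have srho : \forall k \near \oo, rho <= s k.
  (* If [2 * q k < lam - gam], then [(lam - 2 * q k) / q k > gam / lam], whence this growth rate. *)
  apply: (@eventually_ge_of_growth _ _ _ (alpha * (gam / lam))) => //.
    by rewrite mulr_gt0// divr_gt0.
  near=> k.
  have [qlt|qge] := ltP (2 * q k) (lam - gam); [left|right].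
    rewrite hs mE mulrC ler_pM2l// lerD2l ler_pM2l//.
    rewrite ler_pdivrMr// mulrAC ler_pdivlMr//.
    by have /andP[_ qlam] := hq k; have := q0 k; nra.
  (* The first threshold makes [t k] at most [del ^+ 2 / 2]; the second bounds the one-step change
     [d] of [s] by [rho]. *)
  have Gk1 : G k < gam ^+ 2 * (del ^+ 2 / (2 * lam)).
    near: k; apply: Glt.
    by rewrite mulr_gt0 ?exprn_gt0// divr_gt0 ?exprn_gt0// mulr_gt0.
  have Gk2 : G k < P * del ^+ 2 * rho ^+ 2.
    by near: k; apply: Glt; rewrite mulr_gt0 ?exprn_gt0// mulr_gt0 ?exprn_gt0.
  have ek : e k <= del ^+ 2 / (2 * lam).
    rewrite -(ler_pM2l (exprn_gt0 2 gam0)).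
    exact: le_trans (he k qge) (ltW Gk1).
  have tk : t k <= del ^+ 2 / 2.
    have /andP[_] := ht k; move/le_trans; apply.
    rewrite -(ler_pM2l lam0) in ek; apply: (le_trans ek).
    by rewrite le_eqVlt; apply/orP; left; apply/eqP; field; rewrite gt_eqF.
  have sk : 2 * rho <= s k.
    rewrite -ler_sqr ?nnegrE ?mulr_ge0//; try exact: ltW.
    have lP : 0 < lam * P by rewrite mulr_gt0.
    rewrite -(ler_pM2l lP) rho2.
    have /andP[qd _] := hq k; have := hq2 k.
    have : del ^+ 2 <= q k ^+ 2 by rewrite ler_sqr// nnegrE ltW.
    by lra.
  split=> //.
  pose d := s k * (alpha * ((lam - 2 * q k) / q k)).
  have -> : s k.+1 = s k + d by rewrite hs mE mulrDr mulr1.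
  have d2 : d ^+ 2 <= rho ^+ 2.
    have -> : d ^+ 2 = alpha ^+ 2 *
        (((lam - 2 * q k) ^+ 2 * (P * s k ^+ 2)) / (P * q k ^+ 2)).
      by rewrite /d; field; rewrite !gt_eqF.
    apply: le_trans (ler_piMl _ _) _.
    - have PX0 (z : R) : 0 <= P * z ^+ 2 by rewrite mulr_ge0 ?sqr_ge0// ltW.
      by rewrite divr_ge0// mulr_ge0// sqr_ge0.
    - by rewrite exprn_ile1// ltW.
    rewrite ler_pdivrMr ?mulr_gt0 ?exprn_gt0//.
    apply: (le_trans (hp k)); apply: (le_trans (ltW Gk2)).
    rewrite [rho ^+ 2 * _]mulrC ler_pM2r ?exprn_gt0// ler_pM2l//.
    by have /andP[qd _] := hq k; rewrite ler_sqr// nnegrE ltW.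
  rewrite leNgt; apply/negP => lt_rho.
  have : d < - rho by lra.
  by move=> dlt; nra.
have lamq0 : (lam - 2 * q k) ^+ 2 @[k --> \oo] --> (0 : R).
  have c0 : (P * rho ^+ 2)^-1 * G k @[k --> \oo] --> (0 : R).
    by rewrite -(mulr0 (P * rho ^+ 2)^-1); apply: cvgM => //; exact: cvg_cst.
  apply: squeeze_cvgr c0; last exact: cvg_cst.
  near=> k; rewrite sqr_ge0 ler_pdivlMl//=.
  apply: le_trans (hp k); rewrite mulrC ler_wpM2l ?sqr_ge0// ler_pM2l//.
  by rewrite ler_sqr ?nnegrE; [near: k|exact: ltW..].
have qcvg : q @ \oo --> lam / 2.
  have nq : `|lam - 2 * q k| @[k --> \oo] --> (0 : R).
    have -> : (fun k => `|lam - 2 * q k|) =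
        (fun k => Num.sqrt ((lam - 2 * q k) ^+ 2)).
      by apply/funext => k; rewrite sqrtr_sqr.
    rewrite -sqrtr0; apply: continuous_cvg lamq0; exact: sqrt_continuous.
  have -> : q = (fun k => lam / 2 - 2^-1 * (lam - 2 * q k)).
    by apply/funext => k; field.
  rewrite -[X in _ --> X]subr0; apply: cvgB; first exact: cvg_cst.
  by rewrite -(mulr0 2^-1); apply: cvgM; [exact: cvg_cst|exact: norm_cvg0].
(* Since [2 * q k] tends to [lam], it eventually exceeds [lam - gam], where [he] applies. *)
have ecvg : e @ \oo --> 0.
  have c0 : (gam ^+ 2)^-1 * G k @[k --> \oo] --> (0 : R).
    by rewrite -(mulr0 (gam ^+ 2)^-1); apply: cvgM => //; exact: cvg_cst.
  apply: squeeze_cvgr c0; last exact: cvg_cst.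
  near=> k; rewrite e0 ler_pdivlMl ?exprn_gt0//=; apply: he.
  rewrite mulrC -ler_pdivrMr// ltW//; near: k.
  by apply: cvgr_gt qcvg _ _; rewrite ltr_pM2r// ltrBlDr ltrDl.
split=> //.
have tcvg : t @ \oo --> 0.
  have c0 : lam * e k @[k --> \oo] --> (0 : R).
    by rewrite -(mulr0 lam); apply: cvgM => //; exact: cvg_cst.
  by apply: squeeze_cvgr c0; [apply: nearW => k; exact: ht|exact: cvg_cst].
(* [hq2] solved for the positive [s k]; continuity then gives the limit. *)
have -> : s = (fun k => Num.sqrt ((lam * P)^-1 * (q k ^+ 2 - t k))).
  apply/funext => k; rewrite hq2 addrK mulKf ?gt_eqF ?mulr_gt0//.
  by rewrite sqrtr_sqr gtr0_norm.
apply: continuous_cvg; first exact: sqrt_continuous.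
have -> : lam / (4 * P) = (lam * P)^-1 * ((lam / 2) ^+ 2 - 0).
  by field; rewrite !gt_eqF.
apply: cvgM; first exact: cvg_cst.
by apply: cvgB => //; apply: cvgM.
Unshelve. all: by end_near.
Qed.

(** * Convergence of the iterates off the kernel of the projection *)

Lemma dot_sqrZB (R : realType) (n : nat) (c : R) (u v : 'cV[R]_n) :
  dot (c *: u - v) (c *: u - v) = c ^+ 2 * dot u u - 2 * c * dot u v + dot v v.
Proof.
by rewrite !(dotDl, dotDr, dotNl, dotNr, dotZl, dotZr) [dot v u]dotC; ring.
Qed.

(** Passes to the sup norm: each squared coordinate is at most the Euclidean square. *)
Lemma cvg0_of_dot (R : realType) (n : nat) (y : nat -> 'cV[R]_n) :
  dot (y k) (y k) @[k --> \oo] --> (0 : R) -> y @ \oo --> (0 : 'cV[R]_n).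
Proof.
move=> y0; apply/cvgr0Pnorm_lt => eps eps0.
near=> k.
have yk : dot (y k) (y k) < eps ^+ 2.
  by near: k; apply: (cvgr_lt _ y0); rewrite exprn_gt0.
have -> : `|y k| = mx_norm (y k) by [].
rewrite mx_normE; apply: (big_ind (fun a : {nonneg R} => a%:num < eps)) => //=.
  by move=> a b la lb; rewrite /Num.max; case: ifP.
move=> [i j] _ /=.
rewrite ord1 -sqrtr_sqr -[eps]gtr0_norm// -sqrtr_sqr ltr_sqrt ?exprn_gt0//.
exact: le_lt_trans (sqr_coord_le_dot _ _) yk.
Unshelve. all: by end_near.
Qed.

(** Pythagoras: [|x - Pi x|^2 = |x|^2 - |Pi x|^2]. *)
Lemma dot_proj_le (R : realType) (n : nat) (Pi : 'M[R]_n) (x : 'cV[R]_n) :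
  Pi^T = Pi -> Pi *m Pi = Pi -> dot (Pi *m x) (Pi *m x) <= dot x x.
Proof.
move=> symPi idPi; have := dot_ge0 (x - Pi *m x).
have PP : dot (Pi *m x) (Pi *m x) = dot x (Pi *m x).
  by rewrite [RHS]dot_mulmxr symPi dot_mulmxr symPi mulmxA idPi dotC.
rewrite !(dotDl, dotDr, dotNl, dotNr) [dot (_ *m _) x]dotC PP.
by move=> ?; lra.
Qed.

(** Splitting [x k] into [Pi *m x k] and the orthogonal remainder [y k] reduces the iteration to
    [scalar_dynamics_cvg]. *)
Lemma gradient_descent_cvg (R : realType) (n : nat) (A Pi : 'M[R]_n)
    (alpha lam gam : R) (x0 : 'cV[R]_n) :
  A^T = A -> psd A -> 0 < alpha < 1 -> 0 < lam -> 0 < gam ->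
  Pi^T = Pi -> Pi *m Pi = Pi -> A *m Pi = lam *: Pi ->
  (forall x, quad A x <= lam * dot x x) ->
  (forall y, Pi *m y = 0 -> quad A y <= (lam - gam) * dot y y) ->
  objective A x0 < 0 -> Pi *m x0 != 0 ->
  exists2 xs, global_minimizer (objective A) xs &
    gradient_descent (objective A) alpha x0 k @[k --> \oo] --> xs.
Proof.
move=> symA psdA alpha01 lam0 gam0 symPi idPi APi quad_le gap fx0 Px0.
have PiA : Pi *m A = lam *: Pi.
  by rewrite -[in LHS]symPi -[A]symA -trmx_mul APi linearZ /= symPi.
pose x := gradient_descent (objective A) alpha x0.
pose q k := Num.sqrt (quad A (x k)).
have fx k : objective A (x k) < 0 by exact: objective_gradient_descent_lt0.
have quad0 k : 0 < quad A (x k) by exact: quad_gt0_of_objective_lt0.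
have q0 k : 0 < q k by rewrite sqrtr_gt0.
have q2 k : q k ^+ 2 = quad A (x k) by rewrite sqr_sqrtr.
have qlam k : q k < lam by exact: sqrt_quad_lt.
have qdel k : - objective A x0 <= q k.
  have : objective A (x k) <= objective A x0.
    exact: (objective_gradient_descent_noninc symA psdA alpha01 fx0 (leq0n k)).
  have -> : objective A (x k) = dot (x k) (x k) - q k.
    by rewrite /objective enorm_sqr.
  by have := dot_ge0 (x k); lra.
pose m k := 1 - 2 * alpha + alpha * lam / q k.
pose s k := \prod_(i < k) m i.
pose P := dot (Pi *m x0) (Pi *m x0).
have P0 : 0 < P.
  by rewrite lt_def dot_ge0 andbT; apply: contra_neq Px0 => /dot_eq0.
pose h k := (2 * q k) *: x k - A *m x k.
have hE k : h k = q k *: gradient (objective A) (x k).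
  rewrite gradient_objective// -/(q k) scalerBr scalerA mulrC scalerA.
  by rewrite divff ?scale1r// gt_eqF.
have Pih k : Pi *m h k = (2 * q k - lam) *: (Pi *m x k).
  by rewrite /h mulmxBr mulmxA PiA -scalemxAr -scalemxAl -scalerBl.
have Pix k : Pi *m x k = s k *: (Pi *m x0).
  elim: k => [|k IH]; first by rewrite /s big_ord0 scale1r.
  rewrite /x gradient_descentS -/x /s big_ord_recr /= -/(s k) mulrC -scalerA.
  rewrite -IH.
  have -> : gradient (objective A) (x k) = (q k)^-1 *: h k.
    by rewrite hE scalerA mulVf ?scale1r// gt_eqF.
  rewrite mulmxBr -!scalemxAr Pih !scalerA -[X in X - _]scale1r -scalerBl.
  by congr (_ *: _); rewrite /m; field; rewrite gt_eqF.
pose y k := x k - Pi *m x k.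
have Piy k : Pi *m y k = 0 by rewrite /y mulmxBr mulmxA idPi subrr.
have xE k : x k = Pi *m x k + y k by rewrite /y addrCA subrr addr0.
have orth k z : dot (y k) (Pi *m z) = 0.
  by rewrite dot_mulmxr symPi Piy dotC dot0r.
have PPx k : dot (Pi *m x k) (Pi *m x k) = P * s k ^+ 2.
  by rewrite Pix dotZl dotZr /P; ring.
have quadx k : quad A (x k) = lam * P * s k ^+ 2 + quad A (y k).
  rewrite {1}xE quadD// [A *m (Pi *m _)]mulmxA APi -scalemxAl dotZr orth.
  rewrite !mulr0 addr0.
  by rewrite quadE mulmxA APi -scalemxAl dotZr PPx mulrA.
have hh k : (2 * q k - lam) * dot (y k) (y k) +
    (lam * dot (y k) (y k) - quad A (y k)) = dot (y k) (h k).
  rewrite /h {1 2}xE mulmxDr mulmxA APi -scalemxAl scalerDr.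
  by rewrite !(dotDr, dotNr, dotZr) orth -quadE; ring.
have Gcvg : dot (h k) (h k) @[k --> \oo] --> (0 : R).
  have c0 : lam ^+ 2 * dot (gradient (objective A) (x k))
      (gradient (objective A) (x k)) @[k --> \oo] --> (0 : R).
    rewrite -(mulr0 (lam ^+ 2)); apply: cvgM; first exact: cvg_cst.
    exact: (gradient_cvg0 symA psdA alpha01 lam0 quad_le fx0).
  apply: squeeze_cvgr c0; last exact: cvg_cst.
  apply: nearW => k; rewrite dot_ge0 hE dotZl dotZr mulrA -expr2 /=.
  by rewrite ler_wpM2r ?dot_ge0// ler_sqr ?nnegrE; exact: ltW.
have Pih_le k : (lam - 2 * q k) ^+ 2 * (P * s k ^+ 2) <= dot (h k) (h k).
  apply: le_trans (dot_proj_le (h k) symPi idPi).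
  by rewrite Pih dotZl dotZr PPx [leRHS]mulrA -expr2 -[_ - lam]opprB sqrrN.
have y_le k : lam - gam / 2 <= 2 * q k ->
    (gam / 2) ^+ 2 * dot (y k) (y k) <= dot (h k) (h k).
  (* [0 <= |(gam / 2) y - h|^2] together with [y . h >= (gam / 2) |y|^2] *)
  move=> qk; have := dot_ge0 ((gam / 2) *: y k - h k).
  rewrite dot_sqrZB -hh.
  have := gap _ (Piy k); have := dot_ge0 (y k).
  set Y := dot (y k) (y k); set Q := quad A (y k) => Y0 Qle.
  have : 0 <= gam * ((2 * q k - lam + gam / 2) * Y).
    by rewrite mulr_ge0 ?mulr_ge0//; lra.
  have : 0 <= gam * ((lam - gam) * Y - Q).
    by rewrite mulr_ge0//; lra.
  by move=> *; lra.
have [scvg ycvg] : s @ \oo --> Num.sqrt (lam / (4 * P)) /\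
    dot (y k) (y k) @[k --> \oo] --> (0 : R).
  (* [y . h >= (2 q - lam + gam) |y|^2], so half the gap survives once [2 q >= lam - gam / 2]. For
     the lower bound on [q]: [q_k >= - f x_k >= - f x_0]. *)
  apply: (@scalar_dynamics_cvg R lam (gam / 2) (- objective A x0) alpha P
    q s _ (fun k => quad A (y k)) (fun k => dot (h k) (h k))) => //.
  - by rewrite divr_gt0.
  - by rewrite oppr_gt0.
  - by move=> k; rewrite qdel qlam.
  - by rewrite /s big_ord0.
  - by move=> k; rewrite /s big_ord_recr.
  - by move=> k; exact: dot_ge0.
  - by move=> k; rewrite psdA quad_le.
  - by move=> k; rewrite q2 quadx.
(* Top eigenvector with squared norm [lam / 4], at which the bound of [objective_ge] is attained. *)
pose xs := Num.sqrt (lam / (4 * P)) *: (Pi *m x0).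
have lP0 : 0 < lam / (4 * P) by rewrite divr_gt0// mulr_gt0.
exists xs.
  have xsE : dot xs xs = lam / 4.
    rewrite /xs dotZl dotZr mulrA -expr2 sqr_sqrtr ?ltW// -/P.
    by field; rewrite gt_eqF.
  have quadxs : quad A xs = (lam / 2) ^+ 2.
    have Axs : A *m xs = lam *: xs.
      by rewrite /xs -scalemxAr mulmxA APi -scalemxAl !scalerA mulrC.
    by rewrite quadE Axs dotZr xsE; field.
  move=> z; apply: le_trans (objective_ge psdA lam0 quad_le z).
  rewrite /objective enorm_sqr xsE quadxs sqrtr_sqr gtr0_norm ?divr_gt0//.
  by lra.
have -> : gradient_descent (objective A) alpha x0 =
    (fun k => s k *: (Pi *m x0) + y k).
  by apply/funext => k; rewrite -Pix -xE.
rewrite -[xs]addr0; apply: cvgD; last exact: cvg0_of_dot.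
by apply: cvgZ => //; exact: cvg_cst.
Qed.

(** * Hyperplanes are Lebesgue null *)

(* Stated for arbitrary subsets: lebesgue_cV has no measure structure, in
   particular it is not known to be monotone. *)
Lemma lebesgue_cV_subset_hyperplane (R : realType) (n : nat) (a : 'cV[R]_n)
    (c : R) (S : set (borel_cV R n)) :
  a != 0 -> (forall x : 'cV[R]_n, S x -> dot a x = c) ->
  @lebesgue_cV R n S = 0%E.
Proof.
elim: n a c S => [|n IH] a c S a0 Sc.
  by rewrite flatmx0 eqxx in a0.
rewrite /= /pushforward /product_measure1.
set T := (X in xsection X).
pose a' : 'cV[R]_n := \col_i a (lift ord0 i) 0.
have col0 (x : R) (v : 'cV[R]_n) :
    (col_mx (const_mx x : 'cV[R]_1) v : 'cV[R]_n.+1) ord0 0 = x.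
  have e : (ord0 : 'I_n.+1) = lshift n (ord0 : 'I_1) by apply: val_inj.
  by rewrite e (@col_mxEu R 1 n 1) mxE.
have colS (x : R) (v : 'cV[R]_n) i :
    (col_mx (const_mx x : 'cV[R]_1) v : 'cV[R]_n.+1) (lift ord0 i) 0 = v i 0.
  have -> : lift ord0 i = rshift 1 i by apply: val_inj.
  by rewrite (@col_mxEd R 1 n 1).
have Tc x v : xsection T x v -> a ord0 0 * x + dot a' v = c.
  rewrite /xsection /= inE => /Sc <-.
  rewrite !dotE big_ord_recl col0; congr (_ + _).
  by apply: eq_bigr => i _; rewrite colS mxE.
(* If [a'] is nonzero, every slice lies in a hyperplane of lower dimension. Otherwise only the slice
   at [c / a ord0 0] can be nonempty, and a single point does not affect the integral. *)
have [a'0|a'N] := eqVneq a' 0; last first.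
  apply: integral0_eq => x _ /=; apply: (IH a' (c - a ord0 0 * x)) => // v.
  by move/Tc <-; rewrite addrC addKr.
have a00 : a ord0 0 != 0.
  apply: contra_neq a0 => a00; apply/colP => i; rewrite mxE.
  have [j ->|->//] := unliftP ord0 i.
  by move/colP: a'0 => /(_ j); rewrite !mxE.
pose r := c / a ord0 0.
have out x : x != r -> @lebesgue_cV R n (xsection T x) = 0%E.
  move=> xr; rewrite -(lebesgue_cV0 R n); congr (lebesgue_cV _).
  apply/seteqP; split=> v //= /Tc; rewrite a'0 dotC dot0r addr0 => ac.
  by move/eqP: xr; apply; rewrite /r -ac mulrC mulKf.
rewrite -(@integral_setD1 _ _ r).
- by apply: integral0_eq => x [_ /eqP] /=; exact: out.
- exact: measurableD.
- apply: (eq_measurable_fun (cst 0%E)) => // x.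
  by rewrite inE => -[_ /eqP xr] /=; rewrite out.
Qed.

(** * Continuity and measurability *)

Lemma continuous_sum (R : realType) (T : topologicalType) (I : Type)
    (r : seq I) (f : I -> T -> R) :
  (forall i, continuous (f i)) -> continuous (fun x => \sum_(i <- r) f i x).
Proof.
move=> cf; elim: r => [|i r IH] x.
  by under eq_fun do rewrite big_nil; exact: cvg_cst.
under eq_fun do rewrite big_cons.
by apply: cvgD; [exact: cf|exact: IH].
Qed.

Lemma continuous_dot (R : realType) (n : nat) (a : 'cV[R]_n) :
  continuous (dot a).
Proof.
have -> : dot a = (fun z => \sum_i a i 0 * z i 0).
  by apply/funext => z; rewrite dotE.
apply: continuous_sum => i x.
apply: (@cvgM _ _ (nbhs x) _ (fun=> a i 0) (fun z => z i 0)).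
  exact: cvg_cst.
exact: coord_continuous.
Qed.

Lemma continuous_quad (R : realType) (n : nat) (M : 'M[R]_n) :
  continuous (quad M).
Proof.
have -> : quad M = (fun z => \sum_i z i 0 * dot (row i M)^T z).
  apply/funext => z; rewrite quadE dotE; apply: eq_bigr => i _.
  by rewrite /dot trmxK -row_mul [in RHS]mxE.
apply: continuous_sum => i x.
apply: (@cvgM _ _ (nbhs x) _ (fun z => z i 0) (dot (row i M)^T)).
  exact: coord_continuous.
exact: continuous_dot.
Qed.

Lemma continuous_objective (R : realType) (n : nat) (A : 'M[R]_n) :
  continuous (objective A).
Proof.
move=> x.
have -> : objective A = (fun z => quad 1%:M z - Num.sqrt (quad A z)).
  by apply/funext => z; rewrite /objective enorm_sqr [quad 1%:M z]quadE mul1mx.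
apply: (@cvgB _ _ _ (nbhs x) _ (quad 1%:M) (fun z => Num.sqrt (quad A z))).
  exact: continuous_quad.
apply: continuous_comp; first exact: continuous_quad.
exact: sqrt_continuous.
Qed.

Lemma measurable_objective_lt0 (R : realType) (n : nat) (A : 'M[R]_n) :
  measurable ([set x | objective A x < 0] : set (borel_cV R n)).
Proof.
apply: sub_sigma_algebra.
have -> : [set x | objective A x < 0] = objective A @^-1` [set z | z < 0] by [].
apply: open_comp; last exact: open_lt.
by move=> x _; exact: continuous_objective.
Qed.

(** * Almost sure convergence *)

Theorem theorem3p3 (R : realType) (n r : nat) (A : 'M[R]_n) (alpha : R)
    (P : probability (borel_cV R n) R) :
  A^T = A -> psd A -> \rank A = r -> (1 <= r)%N ->
  0 < alpha < 1 ->
  P `<< @lebesgue_cV R n ->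
  P [set x : borel_cV R n | objective A x < 0] = 1%E ->
  {ae P, forall x0 : borel_cV R n, exists2 xs : 'cV[R]_n,
     global_minimizer (objective A) xs &
     gradient_descent (objective A) alpha x0 k @[k --> \oo] --> xs}.
Proof.
move=> symA psdA _ _ alpha01 Pac Pneg.
have mneg := measurable_objective_lt0 A.
set N := [set x : borel_cV R n | objective A x < 0] in Pneg mneg.
(* A point of negative objective provides the positive value of [quad A] from which the
   eigenprojection is built. *)
have [x1 fx1] : N !=set0.
  apply/set0P/eqP => N0; move: Pneg; rewrite N0 measure0 => /eqP.
  by rewrite eq_sym onee_eq0.
have [lam [gam [Pi [[lam0 gam0 Pi0] [symPi idPi APi quad_le gap]]]]] :=
  top_eigenprojection symA (ex_intro _ x1 (quad_gt0_of_objective_lt0 fx1)).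
(* A nonzero row of [Pi] is normal to a hyperplane [H] containing the kernel of [Pi]. *)
have [i rowi] : exists i, row i Pi != 0.
  apply/existsP; apply: contraNT Pi0 => /existsPn Pi0.
  apply/eqP/row_matrixP => i; rewrite row0.
  by apply/eqP; rewrite -[_ == _]negbK Pi0.
pose a : 'cV[R]_n := (row i Pi)^T.
have a0 : a != 0 by rewrite -(inj_eq trmx_inj) trmxK trmx0.
pose H := [set x : borel_cV R n | dot a x = 0].
have mH : measurable H.
  rewrite -[H]setCK; apply: measurableC; apply: sub_sigma_algebra.
  have -> : ~` H = dot a @^-1` [set z | z != 0].
    by apply/seteqP; split => z /= /eqP.
  apply: open_comp; last exact: open_neq.
  by move=> x _; exact: continuous_dot.
(* Nullity of [H] for [lebesgue_cV] is tested on all measurable subsets [S] of [H]. *)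
have PH : P H = 0%E.
  apply: (Pac H) => // S mS SH.
  by apply: (lebesgue_cV_subset_hyperplane a0 (c := 0)) => x /SH.
have PN : P (~` N) = 0%E by rewrite probability_setC// Pneg subee.
exists (H `|` ~` N); split.
- by apply: measurableU => //; exact: measurableC.
- by apply: null_set_setU => //; exact: measurableC.
move=> x0; rewrite -[in X in _ -> X](setCK (_ `|` _)); apply: contra_not.
rewrite setCU setCK => -[/= Hx0 fx0].
apply: (gradient_descent_cvg symA psdA alpha01 lam0 gam0 symPi idPi APi quad_le
  gap fx0).
apply/eqP => Pix0; apply: Hx0.
by rewrite /H /= /dot trmxK -row_mul Pix0 row0 mxE.
Qed.
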